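(* For an oracle $A$ the following are equivalent: (i) $A$ computes a trace that traces every computable function; (ii) $A$ computes a partial trace that traces every computable function.
   Context: A trace (slalom) computable in $A$ is a function $\sigma$ from $\omega$ to finite subsets of $\omega$ with $|\sigma(n)|\le n$ for all $n$ such that $\sigma(n)=D_{p(n)}$ for some $p\le_T A$, where $D_k$ is the $k$-th finite set in a canonical enumeration; $\sigma$ traces $f:\omega\to\omega$ if $f(n)\in\sigma(n)$ for almost all $n$. A partial trace computed by $A$ is given by an infinite set $D\subseteq\omega$ that is c.e. in $A$, a partial $A$-computable function $g$ dominating the identity with $D\subseteq\mathrm{dom}(g)$, and a partial $A$-computable function $\sigma$ from $D$ to finite subsets of $\omega$ with $|\sigma(n)|<g(n)$ for all $n\in D$; it traces $f:\omega\to\omega$ if $f(n)\in\sigma(n)$ for all but finitely many $n\in D$. *)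

(* Defs.v *)
From Stdlib Require Cantor.
From mathcomp Require Import all_boot finmap.
From mathcomp Require Import boolp classical_sets functions cardinality.

Set Implicit Arguments.
Unset Strict Implicit.
Unset Printing Implicit Defensive.

Local Open Scope classical_set_scope.

Definition cpair (a b : nat) : nat := Cantor.to_nat (a, b).

(* Kleene's mu-recursive functions with an oracle, presented with one         *)
(* argument: tuples are passed through the Cantor pairing bijection, and the  *)
(* pairing and its two projections replace arities and projections.           *)
Inductive code : Type :=
| Zero
| Succ
| Fst
| Snd
| Oracle
| Pair of code & code
| Comp of code & code
| Prec of code & code
| Mu of code.

(* [eval A c n y]: the program c with oracle A halts on input n and outputs y *)
(* In [eval_Mu], [h] collects the nonzero values (h z).+1 found below the     *)
(* least zero, so that the search diverges if an earlier value is undefined.  *)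
Inductive eval (A : set nat) : code -> nat -> nat -> Prop :=
| eval_Zero n : eval A Zero n 0
| eval_Succ n : eval A Succ n n.+1
| eval_Fst a b : eval A Fst (cpair a b) a
| eval_Snd a b : eval A Snd (cpair a b) b
| eval_Oracle n : eval A Oracle n (n \in A)
| eval_Pair c d n a b :
    eval A c n a -> eval A d n b -> eval A (Pair c d) n (cpair a b)
| eval_Comp c d n m y :
    eval A d n m -> eval A c m y -> eval A (Comp c d) n y
| eval_Prec0 c d a y :
    eval A c a y -> eval A (Prec c d) (cpair a 0) y
| eval_PrecS c d a k r y :
    eval A (Prec c d) (cpair a k) r ->
    eval A d (cpair a (cpair k r)) y ->
    eval A (Prec c d) (cpair a k.+1) y
| eval_Mu c a y (h : nat -> nat) :
    (forall z, z < y -> eval A c (cpair a z) (h z).+1) ->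
    eval A c (cpair a y) 0 ->
    eval A (Mu c) a y.

(* A partial function on nat is a function to [option nat], [None] meaning    *)
(* undefined; the metatheory is classical, so its domain is arbitrary.        *)
Definition dom (T : Type) (f : nat -> option T) : set nat :=
  [set n | isSome (f n)].

Definition partial_computable_in (A : set nat) (f : nat -> option nat) : Prop :=
  exists c, forall n y, f n = Some y <-> eval A c n y.

Definition computable_in (A : set nat) (f : nat -> nat) : Prop :=
  partial_computable_in A (fun n => Some (f n)).

Definition computable (f : nat -> nat) : Prop := computable_in set0 f.

Definition ce_in (A D : set nat) : Prop :=
  exists2 f, partial_computable_in A f & D = dom f.

(* The finite set D_k with canonical index k, i.e. k = \sum_(i in D_k) 2 ^ i; *)
(* the bound i < k loses nothing because i < 2 ^ i.                           *)
Definition canonical_fset (k : nat) : {fset nat} :=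
  [fset i in iota 0 k | odd (k %/ 2 ^ i)]%fset.

Definition trace_computable_in (A : set nat) (sigma : nat -> {fset nat}) : Prop :=
  (forall n, #|` sigma n| <= n) /\
  exists2 p, computable_in A p & forall n, sigma n = canonical_fset (p n).

Definition traces (sigma : nat -> {fset nat}) (f : nat -> nat) : Prop :=
  finite_set [set n | f n \notin sigma n].

Definition partial_computable_fset_in (A : set nat)
    (sigma : nat -> option {fset nat}) : Prop :=
  exists2 q, partial_computable_in A q &
    forall n, sigma n = omap canonical_fset (q n).

(* Domination is up to finitely many arguments, as usual in computability.    *)
Definition dominates_id (g : nat -> option nat) : Prop :=
  finite_set [set n | exists2 m, g n = Some m & m < n].

Definition partial_trace_computed_by (A D : set nat) (g : nat -> option nat)
    (sigma : nat -> option {fset nat}) : Prop :=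
  [/\ infinite_set D /\ ce_in A D,
      [/\ partial_computable_in A g, dominates_id g & D `<=` dom g],
      partial_computable_fset_in A sigma /\ dom sigma = D &
      forall n s m, D n -> sigma n = Some s -> g n = Some m -> #|` s| < m].

Definition partial_traces (D : set nat) (sigma : nat -> option {fset nat})
    (f : nat -> nat) : Prop :=
  finite_set [set n | D n /\ ~ exists2 s, sigma n = Some s & f n \in s].

(* Main.v *)
(** If [D] is the domain of a partial trace of all computable functions, then
    [A] can search, for each [n], for some [d >= n] in [D] and output a bound
    [h n] on the elements of the set attached to [d]. A nondecreasing computable
    [f] satisfies [f n <= f d < h n] for almost all [n], so [h] dominates every
    computable function, whatever the size bound of the partial trace was.
    Conversely, once [h] dominates all computable running times, the set of
    outputs on [n] of the first [n] programs, each run for [h n] steps, is a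
    trace of all computable functions.
    Bounded runs are those of a stack machine, whose transition
    function is a case analysis on numbers, so that only its iteration requires
    recursion. *)

Require Import Defs.
From Stdlib Require Cantor.
From mathcomp Require Import all_boot finmap zify.
From mathcomp Require Import boolp classical_sets functions cardinality.

Set Implicit Arguments.
Unset Strict Implicit.
Unset Printing Implicit Defensive.

(** * Pairing, inversion and determinism of evaluation *)

Definition pi1 (n : nat) : nat := (Cantor.of_nat n).1.
Definition pi2 (n : nat) : nat := (Cantor.of_nat n).2.

Lemma pi1_cpair a b : pi1 (cpair a b) = a.
Proof. by rewrite /pi1 /cpair Cantor.cancel_of_to. Qed.

Lemma pi2_cpair a b : pi2 (cpair a b) = b.
Proof. by rewrite /pi2 /cpair Cantor.cancel_of_to. Qed.

Lemma cpair_pi n : cpair (pi1 n) (pi2 n) = n.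
Proof. by rewrite /pi1 /pi2 /cpair -surjective_pairing Cantor.cancel_to_of. Qed.

Definition piE := (pi1_cpair, pi2_cpair).

Local Opaque cpair pi1 pi2.

(** The input is split by [pi1] and [pi2], because an index [cpair a b] is no constructor pattern
    that inversion could match. *)
Lemma eval_inv A c n y : eval A c n y ->
  match c with
  | Zero => y = 0
  | Succ => y = n.+1
  | Fst => y = pi1 n
  | Snd => y = pi2 n
  | Oracle => y = (n \in A)
  | Pair c d => exists a b, [/\ eval A c n a, eval A d n b & y = cpair a b]
  | Comp c d => exists2 m, eval A d n m & eval A c m y
  | Prec c d =>
      if pi2 n is k.+1 then
        exists2 r, eval A (Prec c d) (cpair (pi1 n) k) r &
                   eval A d (cpair (pi1 n) (cpair k r)) y
      else eval A c (pi1 n) y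
  | Mu c => exists2 h : nat -> nat,
      forall z, z < y -> eval A c (cpair n z) (h z).+1 & eval A c (cpair n y) 0
  end.
Proof.
case=> //=; try by move=> *; rewrite !piE.
- by move=> c' d m a b ec ed; exists a, b.
- by move=> c' d m a b ec ed; exists a.
- by move=> c' d a k r z er ed; rewrite !piE; exists r.
- by move=> c' a z h eh e0; exists h.
Qed.

Lemma eval_inj A c n y z : eval A c n y -> eval A c n z -> y = z.
Proof.
move=> e; elim: e z => {c n y}.
- by move=> n z /eval_inv.
- by move=> n z /eval_inv.
- by move=> a b z /eval_inv; rewrite pi1_cpair.
- by move=> a b z /eval_inv; rewrite pi2_cpair.
- by move=> n z /eval_inv.
- by move=> c d n a b _ IHc _ IHd z /eval_inv [a' [b' [/IHc -> /IHd -> ->]]].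
- by move=> c d n m y _ IHd _ IHc z /eval_inv [m' /IHd <- /IHc].
- by move=> c d a y _ IH z /eval_inv; rewrite !piE => /IH.
- move=> c d a k r y _ IHr _ IHd z /eval_inv; rewrite !piE.
  by move=> [r' /IHr <- /IHd].
- move=> c a y h _ IHlt _ IH0 z /eval_inv [h' hlt h0].
  (* If two searches stopped at different points, the value at the smaller one would be both 0 and a
     successor. *)
  by case: (ltngtP y z) => // [/hlt /IH0|/IHlt /(_ _ h0)].
Qed.

(** * Closure properties of the total functions computable in an oracle *)

Definition rec_in (A : set nat) (f : nat -> nat) : Prop :=
  exists c, forall n, eval A c n (f n).

Lemma computableP A f : computable_in A f <-> rec_in A f.
Proof.
split=> [[c cP]|[c cP]]; exists c => n; first by apply/cP.
by move=> y; split=> [[<-] // |e]; rewrite (eval_inj e (cP n)).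
Qed.

Section Comp.
Variable A : set nat.
Implicit Types f g a b k : nat -> nat.

Lemma rec_ext f g : f =1 g -> rec_in A f -> rec_in A g.
Proof. by move=> fg [c cP]; exists c => n; rewrite -fg. Qed.

Lemma rec_id : rec_in A id.
Proof.
exists (Pair Fst Snd) => n; rewrite -{1}(cpair_pi n) -[X in eval _ _ _ X](cpair_pi n).
by apply: eval_Pair; [apply: eval_Fst | apply: eval_Snd].
Qed.

Lemma rec_comp f a : rec_in A f -> rec_in A a -> rec_in A (fun n => f (a n)).
Proof.
by move=> [c cP] [d dP]; exists (Comp c d) => n; apply: eval_Comp (dP n) (cP _).
Qed.

Lemma rec_S a : rec_in A a -> rec_in A (fun n => (a n).+1).
Proof. by apply: (@rec_comp S); exists Succ => n; apply: eval_Succ. Qed.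

Lemma rec_const (m : nat) : rec_in A (fun=> m).
Proof.
elim: m => [|m /rec_S //]; by exists Zero => n; apply: eval_Zero.
Qed.

Lemma rec_oracle a : rec_in A a -> rec_in A (fun n => nat_of_bool (a n \in A)).
Proof.
apply: (@rec_comp (fun n => nat_of_bool (n \in A))).
by exists Oracle => n; apply: eval_Oracle.
Qed.

Lemma rec_pi1 a : rec_in A a -> rec_in A (fun n => pi1 (a n)).
Proof.
apply: (@rec_comp pi1); exists Fst => n.
by rewrite -{1}(cpair_pi n); apply: eval_Fst.
Qed.

Lemma rec_pi2 a : rec_in A a -> rec_in A (fun n => pi2 (a n)).
Proof.
apply: (@rec_comp pi2); exists Snd => n.
by rewrite -{1}(cpair_pi n); apply: eval_Snd.
Qed.

Lemma rec_pair a b : rec_in A a -> rec_in A b -> rec_in A (fun n => cpair (a n) (b n)).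
Proof.
by move=> [c cP] [d dP]; exists (Pair c d) => n; apply: eval_Pair.
Qed.

Lemma rec_iteri (F : nat -> nat -> nat -> nat) k b :
  rec_in A (fun w => F (pi1 w) (pi1 (pi2 w)) (pi2 (pi2 w))) ->
  rec_in A k -> rec_in A b -> rec_in A (fun n => iteri (k n) (F n) (b n)).
Proof.
move=> [d dP] kP [c cP].
have recP : rec_in A (fun w => iteri (pi2 w) (F (pi1 w)) (b (pi1 w))).
  exists (Prec c d) => w; rewrite -{1}(cpair_pi w).
  elim: (pi2 w) => [|i IHi]; first exact: eval_Prec0.
  apply: eval_PrecS IHi _.
  have := dP (cpair (pi1 w) (cpair i (iteri i (F (pi1 w)) (b (pi1 w))))).
  by rewrite !piE.
have := rec_comp recP (rec_pair rec_id kP).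
by apply: rec_ext => n; rewrite !piE.
Qed.

Lemma rec_iter (F : nat -> nat -> nat) k b :
  rec_in A (fun w => F (pi1 w) (pi2 w)) ->
  rec_in A k -> rec_in A b -> rec_in A (fun n => iter (k n) (F n) (b n)).
Proof.
move=> FP kP bP; have : rec_in A (fun n => iteri (k n) (fun=> F n) (b n)).
  apply: (@rec_iteri (fun n _ => F n)) => //.
  have := rec_comp FP (rec_pair (rec_pi1 rec_id) (rec_pi2 (rec_pi2 rec_id))).
  by apply: rec_ext => n; rewrite !piE.
by apply: rec_ext => n; elim: (k n) => //= i ->.
Qed.

Lemma rec_mu (F : nat -> nat -> nat) :
  rec_in A (fun w => F (pi1 w) (pi2 w)) -> (forall n, exists z, F n z = 0) ->
  exists2 m, rec_in A m & forall n, F n (m n) = 0.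
Proof.
move=> [c cP] F0; have F0b n : exists z, F n z == 0.
  by have [z Fz] := F0 n; exists z; apply/eqP.
exists (fun n => ex_minn (F0b n)); last by move=> n; case: ex_minnP => z /eqP.
exists (Mu c) => n; case: ex_minnP => z /eqP Fz zmin.
(* [eval_Mu] asks for the predecessors of the values below the least zero, all of which are
   nonzero. *)
apply: (@eval_Mu _ _ _ _ (fun i => (F n i).-1)) => [i iz|].
  rewrite prednK; first by have := cP (cpair n i); rewrite !piE.
  by rewrite lt0n; apply: contraL iz => /zmin; rewrite leqNgt.
by have := cP (cpair n z); rewrite !piE Fz.
Qed.

Lemma rec_pred a : rec_in A a -> rec_in A (fun n => (a n).-1).
Proof.
apply: (@rec_comp predn).
(* The last index visited by a recursion of length n is n - 1; the start value 0 covers n = 0. *)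
have : rec_in A (fun n => iteri n (fun i _ => i) 0).
  apply: (@rec_iteri (fun _ i _ => i)); last exact: rec_const.
    exact/rec_pi1/rec_pi2/rec_id.
  exact: rec_id.
by apply: rec_ext; case.
Qed.

Lemma rec_add a b : rec_in A a -> rec_in A b -> rec_in A (fun n => a n + b n).
Proof.
move=> aP bP; have : rec_in A (fun n => iter (a n) S (b n)).
  by apply: (@rec_iter (fun=> S)) => //; apply/rec_S/rec_pi2/rec_id.
by apply: rec_ext => n; rewrite iter_succn addnC.
Qed.

Lemma rec_sub a b : rec_in A a -> rec_in A b -> rec_in A (fun n => a n - b n).
Proof.
move=> aP bP; have : rec_in A (fun n => iter (b n) predn (a n)).
  by apply: (@rec_iter (fun=> predn)) => //; apply/rec_pred/rec_pi2/rec_id.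
by apply: rec_ext => n; rewrite iter_predn.
Qed.

(** The constant map to [g n] is iterated |a n - b n| times from [f n], so [f n] survives exactly
    when the two numbers agree. *)
Lemma rec_if a b f g : rec_in A a -> rec_in A b -> rec_in A f -> rec_in A g ->
  rec_in A (fun n => if a n == b n then f n else g n).
Proof.
move=> aP bP fP gP.
have : rec_in A (fun n => iter ((a n - b n) + (b n - a n)) (fun=> g n) (f n)).
  apply: (@rec_iter (fun n _ => g n)) => //; last by apply: rec_add; apply: rec_sub.
  exact: rec_comp gP (rec_pi1 rec_id).
apply: rec_ext => n; rewrite eqn_leq -!subn_eq0 -addn_eq0.
by case: (_ + _).
Qed.

End Comp.

Ltac rec_tac := repeat
  match goal with
  | |- rec_in _ (fun _ => ?k) => apply: rec_const
  | |- rec_in _ (fun n => n) => apply: rec_id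
  | |- rec_in ?A S => exact: (rec_S (rec_id A))
  | |- rec_in ?A pi1 => exact: (rec_pi1 (rec_id A))
  | |- rec_in ?A pi2 => exact: (rec_pi2 (rec_id A))
  | |- rec_in _ (fun n => (@?a n).+1) => apply: rec_S
  | |- rec_in _ (fun n => (@?a n).-1) => apply: rec_pred
  | |- rec_in _ (fun n => pi1 (@?a n)) => apply: rec_pi1
  | |- rec_in _ (fun n => pi2 (@?a n)) => apply: rec_pi2
  | |- rec_in _ (fun n => cpair (@?a n) (@?b n)) => apply: rec_pair
  | |- rec_in _ (fun n => (@?a n) + (@?b n)) => apply: rec_add
  | |- rec_in _ (fun n => (@?a n) - (@?b n)) => apply: rec_sub
  | |- rec_in _ (fun _ => if _ then _ else _) => apply: rec_if
  | H : rec_in ?A ?f |- rec_in ?A (fun n => ?f (@?a n)) => apply: (rec_comp H)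
  end.

(** * A stack machine and its arithmetization *)

(* The state of the machine is a stack of instructions and a current value;   *)
(* the instructions other than programs are the continuations of a program    *)
(* suspended while a subprogram computes the current value.                   *)
Inductive instr : Type :=
| ICode of code
| IPairL of code & nat
| IPairR of nat
| IPrec of code & nat & nat
| IMu of code & nat & nat.

Fixpoint enc (c : code) : nat :=
  match c with
  | Zero => cpair 0 0
  | Succ => cpair 1 0
  | Fst => cpair 2 0
  | Snd => cpair 3 0
  | Oracle => cpair 4 0
  | Pair c d => cpair 5 (cpair (enc c) (enc d))
  | Comp c d => cpair 6 (cpair (enc c) (enc d))
  | Prec c d => cpair 7 (cpair (enc c) (enc d))
  | Mu c => cpair 8 (enc c)
  end.

Definition enc_instr (i : instr) : nat :=
  match i with
  | ICode c => enc c
  | IPairL d n => cpair 9 (cpair (enc d) n)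
  | IPairR a => cpair 10 a
  | IPrec d a k => cpair 11 (cpair (enc d) (cpair a k))
  | IMu c a z => cpair 12 (cpair (enc c) (cpair a z))
  end.

(* The successor keeps the empty stack, coded by 0, apart from all others.    *)
Definition push (i K : nat) : nat := (cpair i K).+1.

Definition enc_stack (K : seq instr) : nat :=
  foldr (fun i => push (enc_instr i)) 0 K.

Definition enc_state (s : seq instr * nat) : nat := cpair (enc_stack s.1) s.2.

(** The oracle is a parameter: the machine runs with [A] to read off a partial trace, and with the
    empty oracle to build a trace. *)
Definition step (o : nat -> nat) (s : seq instr * nat) : seq instr * nat :=
  if s.1 is i :: K then
    let v := s.2 in
    match i with
    | ICode Zero => (K, 0)
    | ICode Succ => (K, v.+1)
    | ICode Fst => (K, pi1 v)
    | ICode Snd => (K, pi2 v)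
    | ICode Oracle => (K, o v)
    | ICode (Pair c d) => (ICode c :: IPairL d v :: K, v)
    | ICode (Comp c d) => (ICode d :: ICode c :: K, v)
    | ICode (Prec c d) =>
        if pi2 v is k.+1
        then (ICode (Prec c d) :: IPrec d (pi1 v) k :: K, cpair (pi1 v) k)
        else (ICode c :: K, pi1 v)
    | ICode (Mu c) => (ICode c :: IMu c v 0 :: K, cpair v 0)
    | IPairL d n => (ICode d :: IPairR v :: K, n)
    | IPairR a => (K, cpair a v)
    | IPrec d a k => (ICode d :: K, cpair a (cpair k v))
    | IMu c a z =>
        if v is 0 then (K, z) else (ICode c :: IMu c a z.+1 :: K, cpair a z.+1)
    end
  else s.

(** Nested equality tests on the tag keep this within the reach of [rec_if]. Tag 12 and all junk
    tags share the last branch. *)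
Definition exec_nat (o : nat -> nat) (i K v : nat) : nat :=
  let t := pi1 i in
  let p := pi2 i in
  let l := pi1 p in
  let r := pi2 p in
  if t == 0 then cpair K 0 else
  if t == 1 then cpair K v.+1 else
  if t == 2 then cpair K (pi1 v) else
  if t == 3 then cpair K (pi2 v) else
  if t == 4 then cpair K (o v) else
  if t == 5 then cpair (push l (push (cpair 9 (cpair r v)) K)) v else
  if t == 6 then cpair (push r (push l K)) v else
  if t == 7 then
    if pi2 v == 0 then cpair (push l K) (pi1 v)
    else cpair (push i (push (cpair 11 (cpair r (cpair (pi1 v) (pi2 v).-1))) K))
               (cpair (pi1 v) (pi2 v).-1) else
  if t == 8 then cpair (push p (push (cpair 12 (cpair p (cpair v 0))) K)) (cpair v 0) else
  if t == 9 then cpair (push l (push (cpair 10 v) K)) r else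
  if t == 10 then cpair K (cpair p v) else
  if t == 11 then cpair (push l K) (cpair (pi1 r) (cpair (pi2 r) v)) else
  if v == 0 then cpair K (pi2 r)
  else cpair (push l (push (cpair 12 (cpair l (cpair (pi1 r) (pi2 r).+1))) K))
             (cpair (pi1 r) (pi2 r).+1).

Definition step_nat (o : nat -> nat) (s : nat) : nat :=
  if pi1 s == 0 then s
  else exec_nat o (pi1 (pi1 s).-1) (pi2 (pi1 s).-1) (pi2 s).

Lemma rec_step_nat A o a : rec_in A o -> rec_in A a ->
  rec_in A (fun n => step_nat o (a n)).
Proof.
move=> oP; apply: rec_comp.
rewrite /step_nat /exec_nat /push; rec_tac.
Qed.

Lemma step_natE o s : step_nat o (enc_state s) = enc_state (step o s).
Proof.
rewrite /step_nat /enc_state; case: s => [[|i K] v]; rewrite /step !piE //=.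
rewrite -/(enc_stack K).
case: i => [[| | | | |c d|c d|c d|c]|d n|a|d a k|c a z];
  rewrite /exec_nat /= !piE //=; last by case: v.
by case: (pi2 v).
Qed.

Definition run (o : nat -> nat) (s e n : nat) : nat :=
  iter s (step_nat o) (cpair (push e 0) n).

Lemma runE o s c n : run o s (enc c) n = enc_state (iter s (step o) ([:: ICode c], n)).
Proof.
by rewrite /run; elim: s => //= s ->; rewrite step_natE.
Qed.

Lemma rec_run A o s e n : rec_in A o -> rec_in A s -> rec_in A e -> rec_in A n ->
  rec_in A (fun x => run o (s x) (e x) (n x)).
Proof.
move=> oP sP eP nP; apply: (@rec_iter A (fun=> step_nat o)) => //.
  by apply: rec_step_nat => //; rec_tac.
by rewrite /push; rec_tac.
Qed.

Lemma run_halted o s s' e n :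
  s <= s' -> pi1 (run o s e n) = 0 -> run o s' e n = run o s e n.
Proof.
move=> /subnK <- h; rewrite /run iterD -/(run o s e n).
by elim: (s' - s) => //= k ->; rewrite /step_nat h.
Qed.

(** * Agreement of the machine with [eval] *)

Section Adequacy.
Variables (A : set nat) (o : nat -> nat).
Hypothesis oE : forall n, o n = (n \in A).

(** The arbitrary stack [K] lets the induction hypotheses apply to subprograms, which run above
    suspended instructions. *)
Lemma step_complete c n y : eval A c n y ->
  exists s, forall K, iter s (step o) (ICode c :: K, n) = (K, y).
Proof.
elim=> {c n y}.
- by move=> n; exists 1.
- by move=> n; exists 1.
- by move=> a b; exists 1 => K /=; rewrite /step /= pi1_cpair.
- by move=> a b; exists 1 => K /=; rewrite /step /= pi2_cpair.
- by move=> n; exists 1 => K /=; rewrite /step /= oE.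
- move=> c d n a b _ [s1 h1] _ [s2 h2].
  (* From right to left: unfold the pair, run [c], switch to [d], run [d], form the pair. *)
  exists (1 + (s2 + (1 + (s1 + 1)))) => K.
  by rewrite !iterD /= [X in iter s1 _ X]/step /= h1 [X in iter s2 _ X]/step /= h2.
- move=> c d n m y _ [s1 h1] _ [s2 h2].
  exists (s2 + (s1 + 1)) => K.
  by rewrite !iterD /= [X in iter s1 _ X]/step /= h1 h2.
- move=> c d a y _ [s h]; exists (s + 1) => K.
  by rewrite iterD /= [X in iter s _ X]/step /= !piE.
- move=> c d a k r y _ [s1 h1] _ [s2 h2].
  exists (s2 + (1 + (s1 + 1))) => K.
  by rewrite !iterD /= [X in iter s1 _ X]/step /= !piE h1 [X in iter s2 _ X]/step /= h2.
- move=> c a y h _ IHlt _ [s0 h0].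
  (* Loop invariant: every z up to y gets tested, since the earlier values are nonzero. *)
  have reach z : z <= y -> exists s, forall K,
      iter s (step o) (ICode (Mu c) :: K, a) = (ICode c :: IMu c a z :: K, cpair a z).
    elim: z => [_|z IHz zy]; first by exists 1.
    have [s hs] := IHz (ltnW zy); have [s1 h1] := IHlt z zy.
    by exists (1 + (s1 + s)) => K; rewrite !iterD hs h1.
  have [s hs] := reach y (leqnn y).
  by exists (1 + (s0 + s)) => K; rewrite !iterD hs h0.
Qed.

(** A search entered at [z], as when the machine resumes [IMu]; entered at 0 it is [Mu]. *)
Definition search (c : code) (a z w : nat) : Prop :=
  exists2 h : nat -> nat,
    forall i, z <= i < w -> eval A c (cpair a i) (h i).+1 &
    z <= w /\ eval A c (cpair a w) 0.

Lemma search_step c a z v w : eval A c (cpair a z) v ->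
  (if v is 0 then w = z else search c a z.+1 w) -> search c a z w.
Proof.
case: v => [e ->|v e [h hlt [zw e0]]].
  by exists id => // i; lia.
exists (fun i => if i == z then v else h i); last by split=> //; lia.
move=> i izw; case: eqP => [-> //|iz]; apply: hlt; lia.
Qed.

Definition instr_eval (i : instr) (v y : nat) : Prop :=
  match i with
  | ICode c => eval A c v y
  | IPairL d n => exists2 b, eval A d n b & y = cpair v b
  | IPairR a => y = cpair a v
  | IPrec d a k => eval A d (cpair a (cpair k v)) y
  | IMu c a z => if v is 0 then y = z else search c a z.+1 y
  end.

(** The final value [y] that the suspended computations in [K] deliver from the current value [v],
    expressed through [eval] instead of machine steps. *)
Fixpoint stack_eval (K : seq instr) (v y : nat) : Prop :=
  if K is i :: K' then exists2 m, instr_eval i v m & stack_eval K' m y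
  else v = y.

(* Only this backward direction is needed: it carries a final value back to   *)
(* the initial state without any determinism argument.                        *)
Lemma step_sound s y :
  stack_eval (step o s).1 (step o s).2 y -> stack_eval s.1 s.2 y.
Proof.
case: s => [[|i K] v] //; rewrite /step /=.
case: i => [c|d n|a|d a k|c a z] /=.
- case: c => /=.
  + by exists 0 => //; apply: eval_Zero.
  + by exists v.+1 => //; apply: eval_Succ.
  + exists (pi1 v) => //; rewrite -{1}(cpair_pi v); exact: eval_Fst.
  + exists (pi2 v) => //; rewrite -{1}(cpair_pi v); exact: eval_Snd.
  + exists (o v) => //; rewrite oE; exact: eval_Oracle.
  + move=> c d [a ea [_ [b eb ->] h]].
    by exists (cpair a b) => //; apply: eval_Pair.
  + move=> c d [m ed [x ec h]].
    by exists x => //; apply: eval_Comp ed ec.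
  + move=> c d; case: (pi2 v) (cpair_pi v) => [|k]; move: (pi1 v) => a <- /=.
      by move=> [m e h]; exists m => //; apply: eval_Prec0.
    by move=> [r e1 [m e2 h]]; exists m => //; apply: eval_PrecS e1 e2.
  + move=> c [m e [w hw h]]; exists w => //.
    have [g glt [_ g0]] := search_step e hw.
    by apply: (@eval_Mu _ _ _ _ g) => // z zw; apply: glt.
- move=> [b e [_ -> h]]; exists (cpair v b) => //; by exists b.
- by move=> h; exists (cpair a v).
- by [].
- case: v => [|v] /=; first by exists z.
  by move=> [m e [w hw h]]; exists w => //; apply: search_step e hw.
Qed.

Lemma run_sound s c n :
  pi1 (run o s (enc c) n) = 0 -> eval A c n (pi2 (run o s (enc c) n)).
Proof.
rewrite runE.
have back y : stack_eval (iter s (step o) ([:: ICode c], n)).1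
    (iter s (step o) ([:: ICode c], n)).2 y -> eval A c n y.
  elim: s => [/= [m e <-] //|s IHs /=]; by move/step_sound.
(* A nonempty stack is coded by a successor, so halting means that the stack is empty, where
   [stack_eval] is equality. *)
rewrite /enc_state !piE; case: (iter _ _ _) back => [[|i K] v] //= back _.
exact: back.
Qed.

Lemma run_complete c n y : eval A c n y -> exists s, run o s (enc c) n = cpair 0 y.
Proof.
by move=> /step_complete [s hs]; exists s; rewrite runE hs.
Qed.

End Adequacy.

(** * Arithmetic of canonical indices *)

Lemma rec_odd A a : rec_in A a -> rec_in A (fun n => nat_of_bool (odd (a n))).
Proof.
apply: (@rec_comp _ (fun n => nat_of_bool (odd n))).
have : rec_in A (fun n => iter n (fun r => 1 - r) 0).
  by apply: (@rec_iter _ (fun _ r => 1 - r)); rec_tac.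
by apply: rec_ext; elim=> //= n ->; case: odd.
Qed.

Lemma rec_half A a : rec_in A a -> rec_in A (fun n => (a n)./2).
Proof.
apply: (@rec_comp _ half).
(* Half of n, rounded down, counts the odd numbers below n. *)
have : rec_in A (fun n => iteri n (fun i r => odd i + r) 0).
  apply: (@rec_iteri _ (fun _ i r => odd i + r)); rec_tac.
  by apply: rec_odd; rec_tac.
by apply: rec_ext; elim=> //= n ->; rewrite uphalf_half.
Qed.

Definition add_bit (p y : nat) : nat := if odd (p %/ 2 ^ y) then p else p + 2 ^ y.

Lemma rec_add_bit A a b : rec_in A a -> rec_in A b ->
  rec_in A (fun n => add_bit (a n) (b n)).
Proof.
move=> aP bP.
have pow2 : rec_in A (fun n => iter (b n) (fun r => r + r) 1).
  by apply: (@rec_iter _ (fun _ r => r + r)); rec_tac.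
have div2 : rec_in A (fun n => iter (b n) half (a n)).
  by apply: (@rec_iter _ (fun=> half)) => //; apply: rec_half; rec_tac.
have := rec_if (rec_odd div2) (rec_const A 1) aP (rec_add aP pow2).
apply: rec_ext => n; rewrite /add_bit.
have -> : iter (b n) half (a n) = a n %/ 2 ^ b n.
  by elim: (b n) => [|k /= ->]; rewrite ?divn1 // expnSr divnMA divn2.
have -> : iter (b n) (fun r => r + r) 1 = 2 ^ b n.
  by elim: (b n) => //= k ->; rewrite expnS mul2n addnn.
by case: odd.
Qed.

Lemma in_canonical_fset k i : (i \in canonical_fset k) = odd (k %/ 2 ^ i).
Proof.
rewrite /canonical_fset !inE /= mem_iota add0n /= andbC.
case: (ltnP i k) => [|ki]; rewrite ?andbT // divn_small //.
exact: leq_ltn_trans ki (ltn_expl i _).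
Qed.

Lemma canonical_fset_lt k i : i \in canonical_fset k -> i < k.
Proof. by rewrite /canonical_fset !inE mem_iota => /andP[/andP[_]]. Qed.

Lemma canonical_fset_add_bit p y :
  canonical_fset (add_bit p y) = (y |` canonical_fset p)%fset.
Proof.
apply/fsetP => i; rewrite in_fset1U !in_canonical_fset /add_bit.
case: ifP => [|/negbT py]; first by case: eqP => // ->.
have [iy|yi|->] := ltngtP i y.
(* Below bit y, the added power is an even multiple of 2 ^ i, so the parity of the quotient is
   unchanged. *)
- rewrite addnC -(subnKC iy) expnD expnSr -mulnA [_ * (2 * _)]mulnC divnMDl ?expn_gt0 //.
  by rewrite oddD oddM.
(* Above bit y, nothing is carried because that bit of p is 0. *)
- have divE q : q %/ 2 ^ i = (q %/ 2 ^ y)./2 %/ 2 ^ (i - y.+1).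
    by rewrite -[in LHS](subnKC yi) expnD expnSr !divnMA divn2.
  by rewrite !divE divnDr ?dvdnn // divnn expn_gt0 /= addn1 -uphalfE uphalf_half (negPf py).
- by rewrite divnDr ?dvdnn // divnn expn_gt0 /= addn1 /= py.
Qed.

Lemma finite_set_natP (S : set nat) :
  finite_set S <-> exists N, forall n, S n -> n < N.
Proof.
split=> [/finite_fsetP [X ->]|[N SN]]; last exact: sub_finite_set (finite_II N).
by exists (\max_(i <- X) i).+1 => n /= nX; rewrite ltnS; apply: (leq_bigmax_seq (F := id)).
Qed.

(** * From a partial trace to a dominating function *)

Lemma dominates_computable A D g sigma :
  partial_trace_computed_by A D g sigma ->
  (forall f, computable f -> partial_traces D sigma f) ->
  exists2 h, rec_in A h & forall f, rec_in set0 f -> {homo f : m n / m <= n} ->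
    exists N, forall n, N <= n -> f n < h n.
Proof.
move=> [[Dinf _] _ [[q [c cP] sE] domD] _] Dtr.
have DE d : D d <-> exists y, q d = Some y.
  rewrite -domD /dom /= sE.
  by case: (q d) => [y|]; split=> //; [exists y | case].
pose o n : nat := n \in A.
have oP : rec_in A o by apply: rec_oracle; rec_tac.
(* One number [w] codes both the offset d - n and the number of steps, so a single total search
   dovetails over all d >= n. *)
pose r n w := run o (pi2 w) (enc c) (n + pi1 w).
have rP : rec_in A (fun w => r (pi1 w) (pi2 w)) by apply: rec_run => //; rec_tac.
have [|n|w wP w0] := @rec_mu A (fun n w => pi1 (r n w)); first exact: rec_pi1.
  have [d [/DE [y /cP ey] nd]] : exists d, D d /\ n <= d.
    apply: contrapT => noD; apply/Dinf/finite_set_natP; exists n => d Dd.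
    by rewrite ltnNge; apply/negP => nd; apply: noD; exists d.
  have [s hs] := run_complete (fun n => erefl (o n)) ey.
  by exists (cpair (d - n) s); rewrite /r !piE subnKC // hs piE.
(* The output is the canonical index of the set found, which exceeds every element of that set. *)
exists (fun n => pi2 (r n (w n))).
  apply: rec_pi2; have := rec_comp rP (rec_pair (rec_id A) wP).
  by apply: rec_ext => n; rewrite !piE.
move=> f /computableP /Dtr /finite_set_natP [N hN] fmono; exists N => n Nn.
have /cP qd := run_sound (fun n => erefl (o n)) (w0 n).
set d := n + pi1 (w n) in qd.
have nd : n <= d by apply: leq_addr.
have : exists2 s, sigma d = Some s & f d \in s.
  apply: contrapT => nt; have := hN d; rewrite ltnNge (leq_trans Nn nd) => /(_ _) /negP.
  by apply=> //; split=> //; apply/DE; eexists; exact: qd.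
rewrite sE qd /= => -[_ [<-] /canonical_fset_lt].
exact/leq_ltn_trans/fmono.
Qed.

(** * From a dominating function to a trace *)

Section Trace.
Variables (A : set nat) (h : nat -> nat).
Hypothesis hP : rec_in A h.

(* The programs [i < e] without oracle; numbers that code no program are run  *)
(* as well, which adds junk elements but keeps the cardinality bound.         *)
Definition outputs (n e : nat) : nat :=
  iteri e (fun i p =>
    if pi1 (run (fun=> 0) (h n) i n) == 0
    then add_bit p (pi2 (run (fun=> 0) (h n) i n)) else p) 0.

Lemma rec_outputs : rec_in A (fun n => outputs n n).
Proof.
apply: (@rec_iteri _ (fun n i p =>
    if pi1 (run (fun=> 0) (h n) i n) == 0
    then add_bit p (pi2 (run (fun=> 0) (h n) i n)) else p)); rec_tac.
- by apply: rec_run; rec_tac.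
- apply: rec_add_bit; rec_tac.
  by apply: rec_run; rec_tac.
Qed.

Lemma card_outputs n e : #|` canonical_fset (outputs n e)| <= e.
Proof.
elim: e => [|e IHe].
  by rewrite (_ : canonical_fset _ = fset0) ?cardfs0 //; apply/fsetP => i; rewrite !inE.
rewrite /outputs /= -/(outputs n e); case: ifP => _; last exact: leqW.
rewrite canonical_fset_add_bit cardfsU1 -add1n.
exact: leq_add (leq_b1 _) IHe.
Qed.

Lemma in_outputs n e i y : i < e -> run (fun=> 0) (h n) i n = cpair 0 y ->
  y \in canonical_fset (outputs n e).
Proof.
move=> ie rE; elim: e ie => // e IHe; rewrite ltnS leq_eqVlt /outputs /= -/(outputs n e).
case/predU1P => [<-|/IHe yin]; first by rewrite rE !piE canonical_fset_add_bit fset1U1.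
by case: ifP => // _; rewrite canonical_fset_add_bit fset1Ur.
Qed.

Hypothesis h_dom : forall f, rec_in set0 f -> {homo f : m n / m <= n} ->
    exists N, forall n, N <= n -> f n < h n.

Lemma outputs_trace f : computable f -> traces (fun n => canonical_fset (outputs n n)) f.
Proof.
move=> /computableP [c cP].
have halts n : exists s, run (fun=> 0) s (enc c) n = cpair 0 (f n).
  by apply: (run_complete _ (cP n)) => m; rewrite classical_sets.in_set0.
(* [t n] is a halting time of [c] on n, found without an oracle. *)
have [|n|t tP t0] := @rec_mu set0 (fun n s => pi1 (run (fun=> 0) s (enc c) n)).
- by apply: rec_pi1; apply: rec_run; rec_tac.
- by have [s hs] := halts n; exists s; rewrite hs piE.
(* [h] only dominates nondecreasing functions, so running times are summed. *)
pose F n := iteri n.+1 (fun i r => t i + r) 0.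
have FP : rec_in set0 F.
  by apply: (@rec_iteri _ (fun _ i r => t i + r)); rec_tac.
have [|N hN] := h_dom FP.
  apply: homo_leq => //; first exact: leq_trans.
  by move=> n; rewrite /F [iteri n.+2 _ _]/= leq_addl.
(* Past [N] the time allowed by [h] suffices, and past [enc c] the program [c] is among those
   run. *)
apply/finite_set_natP; exists (maxn N (enc c).+1) => n /=.
apply: contraR; rewrite -leqNgt geq_max => /andP [/hN nN cn].
apply: in_outputs cn _.
have th : t n <= h n by apply: leq_trans (ltnW nN); rewrite /F /= leq_addr.
(* At time [t n] the run is only known to have halted. Comparing it with the run at the maximum of
   [t n] and [s] identifies its output as [f n]. *)
have [s hs] := halts n; rewrite (run_halted th (t0 n)).
rewrite -(run_halted (leq_maxl (t n) s) (t0 n)).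
by rewrite (run_halted (leq_maxr _ _)) hs // piE.
Qed.

End Trace.

(** * Equivalence of the two kinds of trace *)

Theorem theorem8 (A : set nat) :
  (exists sigma : nat -> {fset nat},
      trace_computable_in A sigma /\
      forall f : nat -> nat, computable f -> traces sigma f)
  <->
  (exists (D : set nat) (g : nat -> option nat) (sigma : nat -> option {fset nat}),
      partial_trace_computed_by A D g sigma /\
      forall f : nat -> nat, computable f -> partial_traces D sigma f).
Proof.
split=> [[sigma [[card_sigma [p pP sE]] sigma_tr]]|[D [g [sigma [Dtr str]]]]].
  (* A trace is a partial trace with full domain; the bound n + 1 turns the weak inequality into the
     required strict one. *)
  exists setT, (fun n => Some n.+1), (fun n => Some (sigma n)); split; last first.
    move=> f /sigma_tr; apply: sub_finite_set => n /= [_ nt].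
    by apply/negP => fn; apply: nt; exists (sigma n).
  split.
  - split; first exact: infinite_nat.
    by exists (fun n => Some (p n)) => //; apply/seteqP.
  - split; first by apply/computableP; rec_tac; apply/rec_S/rec_id.
      by apply/finite_set_natP; exists 0 => n [m [<-]]; lia.
    by [].
  - split; last exact/seteqP.
    by exists (fun n => Some (p n)) => // n; rewrite sE.
  - by move=> n s m _ [<-] [<-]; rewrite ltnS.
have [h hP h_dom] := dominates_computable Dtr str.
exists (fun n => canonical_fset (outputs h n n)); split; last exact: outputs_trace.
split; first by move=> n; apply: card_outputs.
by exists (fun n => outputs h n n) => //; apply/computableP/rec_outputs.
Qed.
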